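(* There is an absolute constant $C$ such that the following holds. Let $T$ be a positive number such that $T\ge\frac72\left(\frac{\log d}{k}+1\right)$, and let $\delta\in(0,1)$ be such that $\delta\ge e^{-k}$, where $k=k(n)$. Then for each $n>0$, with probability at least $1-\delta$, $$\sup_{0\le\mathbf{x}\le T}\left|l_n(\mathbf{x})-l(\mathbf{x})\right|\;\le\; C\,d\,\sqrt{\frac{T}{k}\log\frac{d+3}{\delta}}\;+\;\sup_{0\le\mathbf{x}\le 2T}\left|\frac nk\,\tilde F\!\left(\frac kn\mathbf{x}\right)-l(\mathbf{x})\right|.$$
   Context: $\mathbf{X}=(X^1,\ldots,X^d)$ is a random vector in $\mathbb{R}^d$ with distribution function $F$ and continuous marginal distribution functions $F_1,\ldots,F_d$; $\mathbf{X}_1,\ldots,\mathbf{X}_n$ is an i.i.d. sample distributed as $\mathbf{X}$, with $\mathbf{X}_i=(X_i^1,\ldots,X_i^d)$. Put $U^j=1-F_j(X^j)$, which is uniform on $[0,1]$, and $\mathbf U=(U^1,\ldots,U^d)$. For $\mathbf{x}=(x_1,\ldots,x_d)$ with $x_j\ge 0$, define $\tilde F(\mathbf{x})=(1-F)\big((1-F_1)^{\leftarrow}(x_1),\ldots,(1-F_d)^{\leftarrow}(x_d)\big)$, where $(1-F_j)^{\leftarrow}(x_j)=\sup\{y:\ 1-F_j(y)\ge x_j\}$; equivalently $\tilde F(\mathbf{x})=\mathbb{P}\big(\bigcup_{j=1}^d\{U^j\le x_j\}\big)$. Standing assumption: the stable tail dependence function $l(\mathbf{x}):=\lim_{t\downarrow0}t^{-1}\tilde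 F(t\mathbf{x})$ exists for every $\mathbf{x}\in[0,\infty)^d$. $k=k(n)$ is a sequence of positive integers with $k\to\infty$ and $k=o(n)$ as $n\to\infty$. The empirical estimator of $l$ is $$l_n(\mathbf{x})=\frac1k\sum_{i=1}^n\mathbf{1}_{\{X_i^1\ge X^1_{(n-\lfloor kx_1\rfloor+1)}\ \text{or}\ \ldots\ \text{or}\ X_i^d\ge X^d_{(n-\lfloor kx_d\rfloor+1)}\}},$$ where $X^j_{(1)}\le\ldots\le X^j_{(n)}$ are the order statistics of $X^j_1,\ldots,X^j_n$, with the conventions $X^j_{(n+1)}=+\infty$ and $X^j_{(m)}=-\infty$ for $m\le0$. The notation $0\le\mathbf{x}\le T$ means $0\le x_j\le T$ for all $j=1,\ldots,d$. *)

(* Defs.v *)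
(* Conventions: a random vector in R^d is a random variable with values in
   [d.-tuple R], which carries the product (Borel) sigma-algebra; deterministic
   points x of R^d are functions ['I_d -> R]. *)
From HB Require Import structures.
From mathcomp Require Import all_boot all_order all_algebra.
From mathcomp Require Import all_classical all_reals all_analysis.
Set Implicit Arguments.
Unset Strict Implicit.
Unset Printing Implicit Defensive.
Import Order.TTheory GRing.Theory Num.Theory numFieldNormedType.Exports.
Local Open Scope classical_set_scope.
Local Open Scope ring_scope.

Section iid.
Context (disp : measure_display) (Omega : measurableType disp) (R : realType)
  (P : probability Omega R).
Context (disp' : measure_display) (E : measurableType disp').

Definition mutually_independent (n : nat) (X : 'I_n -> {RV P >-> E}) : Prop :=
  forall (J : {set 'I_n}) (A : 'I_n -> set E),
    (forall i, measurable (A i)) ->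
    P (\bigcap_(i in [set` J]) (X i @^-1` A i)) =
    (\prod_(i in J) P (X i @^-1` A i))%E.

Definition same_law (X Y : {RV P >-> E}) : Prop :=
  forall A, measurable A -> distribution P X A = distribution P Y A.

Definition iid_sample (X0 : {RV P >-> E}) (n : nat)
    (X : 'I_n -> {RV P >-> E}) : Prop :=
  mutually_independent X /\ forall i, same_law (X i) X0.

End iid.

Section stable_tail_dependence_function.
Context (disp : measure_display) (Omega : measurableType disp) (R : realType)
  (P : probability Omega R) (d : nat).
Implicit Types (X : {RV P >-> d.-tuple R}) (x : 'I_d -> R).

Definition coordinate X (j : 'I_d) : Omega -> R := fun w => tnth (X w) j.

Lemma measurable_coordinate X j : measurable_fun [set: Omega] (coordinate X j).
Proof.
exact: (measurableT_comp (measurable_tnth j) (measurable_funPT X)).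
Qed.

HB.instance Definition _ X j :=
  isMeasurableFun.Build _ _ _ _ (coordinate X j) (measurable_coordinate X j).

Definition margin_cdf X (j : 'I_d) (y : R) : R :=
  fine (cdf (coordinate X j : {RV P >-> R}) y).

(* F, extended to arguments with infinite coordinates because the generalized
   inverse below takes the values +oo (at 0) and -oo (beyond 1). *)
Definition joint_cdf X (y : 'I_d -> \bar R) : R :=
  fine (P [set w | forall j, ((coordinate X j w)%:E <= y j)%E]).

Definition survival_inv (G : R -> R) (u : R) : \bar R :=
  ereal_sup (EFin @` [set y | u <= 1 - G y]).

Definition Ftilde X x : R :=
  1 - joint_cdf X (fun j => survival_inv (margin_cdf X j) (x j)).

Definition tail_ratio X x (t : R) : R :=
  t^-1 * Ftilde X (fun j => t * x j).

Definition has_stdf X : Prop :=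
  forall x, (forall j, 0 <= x j) -> cvg (tail_ratio X x t @[t --> 0^'+]).

(* Meaningful under [has_stdf X], for x with nonnegative coordinates. *)
Definition stdf X x : R := lim (tail_ratio X x t @[t --> 0^'+]).

End stable_tail_dependence_function.

Section empirical_estimator.
Context (R : realType).

(* m-th smallest of the n values, counted from m = 1; it is -oo for m <= 0 and
   +oo for m > n. *)
Definition order_stat (n : nat) (z : 'I_n -> R) (m : int) : \bar R :=
  if m is Posz p.+1
  then nth +oo%E [seq y%:E | y <- sort <=%R [seq z i | i : 'I_n]] p
  else -oo%E.

Definition emp_stdf (d n k : nat) (z : 'I_n -> d.-tuple R) (x : 'I_d -> R) : R :=
  k%:R^-1 * \sum_(i < n)
    (nat_of_bool [exists j : 'I_d,
       (order_stat (fun i' => tnth (z i') j)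
          (n%:Z - Num.floor (k%:R * x j) + 1) <= (tnth (z i) j)%:E)%E])%:R.

Definition box (d : nat) (T : R) : set ('I_d -> R) :=
  [set x | forall j, 0 <= x j <= T].

Definition box_sup (d : nat) (T : R) (f : ('I_d -> R) -> R) : \bar R :=
  ereal_sup [set (f x)%:E | x in box T].

End empirical_estimator.

(* Main.v *)
Require Import Defs.
From mathcomp Require Import all_boot all_order all_algebra.
From mathcomp Require Import all_classical all_reals all_analysis.
From mathcomp Require Import measurable_realfun ring lra zify.
Set Implicit Arguments.
Unset Strict Implicit.
Unset Printing Implicit Defensive.
Import Order.TTheory GRing.Theory Num.Theory numFieldNormedType.Exports.
Local Open Scope classical_set_scope.
Local Open Scope ring_scope.

(** Each sample enters the estimator through ranks only.  A point is counted at
    [x] when, for some coordinate [j], fewer than [floor (k x_j)] sample points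
    exceed it in that coordinate.  For a level [u], let [tail_set j u] be the
    set of vectors whose [j]-th coordinate lies beyond the upper [u]-quantile of
    the [j]-th margin; by continuity of the margin its mass is [min u 1], and
    [Ftilde u] is the mass of the union over [j] of the sets [tail_set j (u j)]
    ([FtildeE]).

    Two facts give the theorem.

    - Sandwich ([emp_stdf_near_Ftilde]).  If the number of sample points in each
      [tail_set j u] is within [e] of its mean [n u], then the points counted at
      [x] contain the sample points in the union of tail sets at levels
      [(k x_j - e - 1) / n] and are contained in that at levels
      [(k x_j + e) / n].  This needs no random levels and is insensitive to
      ties.  As the masses of the unions at these levels differ from
      [Ftilde (k x / n)] by at most [d (e + 1) / n], the error
      [l_n x - (n / k) Ftilde (k x / n)] is controlled by the deviations of the
      counts in the tail sets and in their unions.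

    - Uniform deviation ([uniform_deviation]).  For levels up to [N / n] in
      each of [m] coordinates, all union counts are within
      [60 m sqrt (N s)] of their means, outside an event of probability at most
      [2 exp (- s)].  A union bound over one fine grid would cost a factor
      logarithmic in [k], so the levels are refined dyadically instead: passing
      from mesh [2^-(r-1)] to [2^-r] changes a union by a set of mean count at
      most [m N / 2^r], while there are at most [2^((r+1)m)] grid points.  By
      Chernoff's bound for such sets of small mass the increments decay like
      [(3/4)^r], and their sum is of the order of the coarsest one.  The
      refinement stops when the mesh contributes as much as the deviations.

    The uniform deviation is used with [m = d] for the unions and with [m = 1]
    for each margin, with [s = ln (4 d / delta)] and [N = 61^2 T k]; the
    hypotheses on [T] and [delta] give [s <= T k], which keeps all levels
    involved below [N / n].  The theorem then follows
    from the triangle inequality through [(n / k) Ftilde (k x / n)].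

    The event of the theorem is measurable because the estimator takes only
    finitely many forms, determined by the pairwise comparisons of the sample
    coordinates ([measurable_emp_stdf_event]). *)

(** * Real-valued probabilities and a union bound *)

Section real_probability.
Context (disp : measure_display) (Omega : measurableType disp) (R : realType)
  (P : probability Omega R).
Implicit Types A B : set Omega.

Lemma fine_probK A : measurable A -> (fine (P A))%:E = P A.
Proof. by move=> mA; rewrite fineK// fin_num_measure. Qed.

Lemma fine_prob_ge0 A : 0 <= fine (P A).
Proof. exact/fine_ge0/measure_ge0. Qed.

Lemma fine_prob_le1 A : measurable A -> fine (P A) <= 1.
Proof. by move=> mA; rewrite -lee_fin fine_probK// probability_le1. Qed.

Lemma le_fine_prob A B : measurable A -> measurable B -> A `<=` B ->
  fine (P A) <= fine (P B).
Proof.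
by move=> mA mB AB; rewrite -lee_fin !fine_probK//; apply: le_measure; rewrite ?inE.
Qed.

Lemma fine_probD A B : measurable A -> measurable B -> A `<=` B ->
  fine (P (B `\` A)) = fine (P B) - fine (P A).
Proof.
move=> mA mB AB; rewrite measureD//; last first.
  by rewrite ltey_eq fin_num_measure.
by rewrite (setIidr AB) fineB// fin_num_measure.
Qed.

Lemma fine_probC A : measurable A -> fine (P (~` A)) = 1 - fine (P A).
Proof.
by move=> mA; rewrite probability_setC// fineB// fin_num_measure.
Qed.

Lemma fine_prob_union_bound (I : finType) (A : set Omega) (F : I -> set Omega) :
  measurable A -> (forall i, measurable (F i)) -> A `<=` \bigcup_i F i ->
  fine (P A) <= \sum_i fine (P (F i)).
Proof.
move=> mA mF AF; rewrite -lee_fin fine_probK// -sumEFin.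
rewrite (eq_bigr (fun i => P (F i))); last by move=> i _; rewrite fine_probK.
pose G k := if insub k is Some i then F (enum_val (i : 'I_#|I|)) else set0.
have GE (i : 'I_#|I|) : G i = F (enum_val i) by rewrite /G valK.
rewrite (reindex (@enum_val I predT)) /=; last by apply: onW_bij; exact: enum_val_bij.
rewrite (eq_bigr (fun i : 'I_#|I| => P (G i))); last by move=> i _; rewrite GE.
apply: content_subadditive => //.
  by move=> k /= _; rewrite /G; case: insubP => // i _ _; exact: mF.
move=> w /AF[i _ Fiw]; rewrite -bigcup_mkord.
by exists (enum_rank i); [exact: ltn_ord | rewrite GE enum_rankK].
Qed.

End real_probability.

(** * Chernoff bounds for the number of sample points in a set *)

Section bernoulli_sums.
Context (disp : measure_display) (Omega : measurableType disp) (R : realType)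
  (P : probability Omega R).
Context (disp' : measure_display) (E : measurableType disp').
Context (X0 : {RV P >-> E}) (n : nat) (X : 'I_n -> {RV P >-> E}).
Hypothesis iidX : iid_sample X0 X.
Implicit Types B : set E.

Definition law_mass B : R := fine (distribution P X0 B).

Definition hits B (w : Omega) : {set 'I_n} := [set i | `[< B (X i w) >]]%SET.

Lemma mem_hits B w i : (i \in hits B w) = `[< B (X i w) >].
Proof. by rewrite inE. Qed.

Lemma prob_sample B i : measurable B -> P (X i @^-1` B) = (law_mass B)%:E.
Proof.
by move=> mB; have [_ /(_ i B mB)] := iidX; rewrite /law_mass fine_probK.
Qed.

(** Independence is a product rule for intersections over the sample; fixing the
    index set of the points that fall in [B] is such an intersection. *)
Lemma hits_eqE B (J : {set 'I_n}) :
  [set w | hits B w = J] =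
  \bigcap_(i in [set` [set: 'I_n]%SET]) (X i @^-1` (if i \in J then B else ~` B)).
Proof.
apply/seteqP; split => [w /= <- i _ /=|w /= h].
  by rewrite mem_hits; case: ifPn => /asboolP.
apply/setP => i; rewrite mem_hits; have := h i; rewrite /= inE => /(_ isT).
by case: ifP => _ Bh; [exact/asboolP | exact/negbTE/asboolPn].
Qed.

Lemma measurable_hits_eq B J : measurable B -> measurable [set w | hits B w = J].
Proof.
move=> mB; rewrite hits_eqE; apply: fin_bigcap_measurable => // i _.
rewrite -[_ @^-1` _]setTI; apply: measurable_funPT => //.
by case: ifP => _ //; exact: measurableC.
Qed.

Lemma prob_hits_eq B J : measurable B ->
  P [set w | hits B w = J] =
  (\prod_i (if i \in J then law_mass B else 1 - law_mass B))%:E.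
Proof.
move=> mB; rewrite hits_eqE iidX.1; last first.
  by move=> i; case: ifP => _ //; exact: measurableC.
rewrite -prodEFin; apply: eq_big => [i|i _]; first by rewrite inE.
case: ifP => _; rewrite prob_sample//; last exact: measurableC.
by rewrite {1}/law_mass fine_probC.
Qed.

Lemma measurable_hits B (Q : pred {set 'I_n}) : measurable B ->
  measurable [set w | Q (hits B w)].
Proof.
move=> mB; have -> : [set w | Q (hits B w)] =
   \bigcup_(J in [set` Q]) [set w | hits B w = J].
  by apply/seteqP; split => [w h|w [J /= h e]]; [exists (hits B w) | rewrite /= e].
by apply: fin_bigcup_measurable => // J _; exact: measurable_hits_eq.
Qed.

(** The inverse of [1 - x <= exp (- x)], with [1 / (1 - x)] expanded to second
    order. *)
Lemma expR_le_quadratic (x : R) : x <= 1 / 2 -> expR x <= 1 + x + 2 * x ^+ 2.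
Proof.
move=> x2; have h := expR_ge1Dx (- x).
have p : 0 < 1 - x by lra.
rewrite -[leLHS]invrK -expRN; apply: le_trans (_ : (1 - x)^-1 <= _).
  by rewrite lef_pV2 ?posrE ?expR_gt0.
rewrite -[leLHS]mul1r ler_pdivrMr//.
have : 0 <= x ^+ 2 * (1 - 2 * x) by apply: mulr_ge0; [exact: sqr_ge0|lra].
by rewrite expr2; nra.
Qed.

Definition deviation B w : R := #|hits B w|%:R - n%:R * law_mass B.

(** The index set of the points in [B] takes finitely many values [J], with
    product probabilities, so Markov's inequality for the exponential moment is
    a termwise comparison of finite sums, and the exponential moment factors by
    expanding the product of the [q exp la + (1 - q)].  The
    quadratic term carries the mean [n q], not [n], so that sets of small mass
    have small deviations. *)
Lemma chernoff B (la t : R) : measurable B -> - (1 / 2) <= la <= 1 / 2 ->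
  fine (P [set w | t <= la * deviation B w]) <=
  expR (2 * la ^+ 2 * (n%:R * law_mass B) - t).
Proof.
move=> mB /andP[la1 la2]; set q := law_mass B.
have q0 : 0 <= q by exact: fine_prob_ge0.
have q1 : q <= 1 by exact: fine_prob_le1.
pose dev (J : {set 'I_n}) := la * (#|J|%:R - n%:R * q).
pose p J := \prod_i (if i \in (J : {set 'I_n}) then q else 1 - q).
have p0 J : 0 <= p J by apply: prodr_ge0 => i _; case: ifP => _; lra.
have mh (Q : pred _) : measurable [set w | Q (hits B w)] by exact: measurable_hits.
apply: le_trans (_ : \sum_J fine (P [set w | (hits B w == J) && (t <= dev J)]) <= _).
  apply: fine_prob_union_bound.
  - exact: (mh (fun J => t <= dev J)).
  - by move=> J; apply: (mh (fun K => (K == J) && (t <= dev J))).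
  - by move=> w /= h; exists (hits B w) => //=; rewrite eqxx.
apply: le_trans (_ : \sum_J p J * expR (dev J - t) <= _).
  (* Markov: on the terms that remain, the exponential is at least 1. *)
  apply: ler_sum => J _; have [h|h] := boolP (t <= dev J); last first.
    rewrite [X in P X](_ : _ = set0) ?measure0 ?mulr_ge0 ?expR_ge0//.
    by apply/seteqP; split => // w /=; rewrite andbF.
  rewrite [X in P X](_ : _ = [set w | hits B w = J]); last first.
    by apply/seteqP; split => w /=; rewrite andbT => /eqP.
  rewrite prob_hits_eq//= -/(p J) ler_peMr//.
  by apply: le_trans (expR_ge1Dx _); lra.
have eJ (J : {set 'I_n}) : expR (la * #|J|%:R) = \prod_i (if i \in J then expR la else 1).
  by rewrite -big_mkcond prodr_const -expRM_natr.
rewrite (eq_bigr (fun J : {set 'I_n} => expR (- (la * (n%:R * q)) - t) *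
    \prod_i (if i \in J then q * expR la else 1 - q))); last first.
  move=> J _; rewrite /dev mulrBr [la * _ - _ - t]addrAC.
  rewrite [_ - _ - _](_ : _ = - (la * (n%:R * q)) - t + la * #|J|%:R); last by ring.
  rewrite expRD mulrCA; congr (_ * _).
  rewrite eJ -big_split /=; apply: eq_bigr => i _.
  by case: ifP => _; rewrite ?mulr1.
rewrite -mulr_sumr -bigA_distr big_const_ord iter_mulr_1.
have h : q * expR la + (1 - q) <= expR (q * (la + 2 * la ^+ 2)).
  apply: le_trans (expR_ge1Dx _).
  have := ler_wpM2l q0 (expR_le_quadratic la2); nra.
apply: le_trans (_ : expR (- (la * (n%:R * q)) - t) *
    expR (q * (la + 2 * la ^+ 2)) ^+ n <= _).
  rewrite ler_pM2l ?expR_gt0// lerXn2r// ?nnegrE ?expR_ge0//.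
  by rewrite addr_ge0 ?mulr_ge0 ?expR_ge0//; lra.
rewrite -expRM_natr -expRD ler_expR le_eqVlt; apply/orP; left; apply/eqP; ring.
Qed.

Lemma two_sided_chernoff B (la t v : R) : measurable B -> 0 < la <= 1 / 2 ->
  n%:R * law_mass B <= v ->
  fine (P [set w | t < `|deviation B w|]) <=
  2 * expR (2 * la ^+ 2 * v - la * t).
Proof.
move=> mB /andP[la0 la2] qv.
pose F b := [set w | la * t <= (if b : bool then la else - la) * deviation B w].
have mF b : measurable (F b).
  exact: (measurable_hits (fun J =>
    la * t <= (if b then la else - la) * (#|J|%:R - n%:R * law_mass B))).
have mA : measurable [set w | t < `|deviation B w|].
  exact: (measurable_hits (fun J => t < `|#|J|%:R - n%:R * law_mass B|)).
have AF : [set w | t < `|deviation B w|] `<=` \bigcup_b F b.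
  move=> w /=; rewrite ltr_normr => /orP[h|h]; [exists true|exists false] => //=.
    by rewrite /F/= ler_pM2l// ltW.
  by rewrite /F/= mulNr -mulrN ler_pM2l// ltW.
apply: le_trans (fine_prob_union_bound P mA mF AF) _.
have h b : fine (P (F b)) <= expR (2 * la ^+ 2 * v - la * t).
  apply: le_trans (chernoff _ mB _) _; first by case: b; lra.
  rewrite ler_expR lerD2r; have -> : (if b then la else - la) ^+ 2 = la ^+ 2.
    by case: b; rewrite ?sqrrN.
  by rewrite ler_wpM2l// mulr_ge0// sqr_ge0.
rewrite big_bool/=; have := h true; have := h false; lra.
Qed.

End bernoulli_sums.

(** * Numerical facts for the dyadic refinement *)

Section dyadic_numerics.
Context (R : realType).

Lemma bernoulli_ge (x : R) r : 0 <= x -> 1 + r%:R * x <= (1 + x) ^+ r.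
Proof.
move=> x0; elim: r => [|r IH]; first by rewrite mul0r addr0 expr0.
rewrite exprS -natr1; apply: le_trans (_ : (1 + x) * (1 + r%:R * x) <= _).
  have : 0 <= r%:R * x * x by rewrite !mulr_ge0.
  nra.
by rewrite ler_pM2l//; lra.
Qed.

Lemma geometric_sum_le (x : R) k : 0 <= x < 1 ->
  \sum_(i < k) x ^+ i <= (1 - x)^-1.
Proof.
move=> /andP[x0 x1]; rewrite -[leRHS]mul1r ler_pdivlMr ?subr_gt0//.
have := subrX1 x k; have := exprn_ge0 k x0; nra.
Qed.

Lemma dyadic_scale (x : R) : 1 <= x -> exists r : nat, 2 ^+ r <= x < 2 ^+ r.+1.
Proof.
move=> x1; have x0 : 0 <= x by lra.
have /andP[t1 t2] := truncn_itv x0.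
have h : (0 < Num.truncn x)%N by rewrite truncn_gt0.
have /andP[h1 h2] := trunc_log_bounds (isT : (1 < 2)%N) h.
exists (trunc_log 2 (Num.truncn x)); apply/andP; split.
  by apply: le_trans t1; rewrite -natrX ler_nat.
by apply: lt_le_trans t2 _; rewrite -natrX ler_nat.
Qed.

Lemma expR2_ge4 : 4 <= expR (2 : R).
Proof.
have e1 : 2 <= expR (1 : R) by have := expR_ge1Dx (1 : R); lra.
have -> : (2 : R) = 1 + 1 by lra.
by rewrite expRD; nra.
Qed.

End dyadic_numerics.

(** * Uniform deviation over unions of nested families *)

Section uniform_deviation.
Context (disp : measure_display) (Omega : measurableType disp) (R : realType)
  (P : probability Omega R).
Context (disp' : measure_display) (E : measurableType disp').
Context (X0 : {RV P >-> E}) (n : nat) (X : 'I_n -> {RV P >-> E}).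
Hypothesis n_gt0 : (0 < n)%N.
Hypothesis iidX : iid_sample X0 X.
Context (m : nat) (B : 'I_m -> R -> set E).
Hypothesis mB : forall j u, measurable (B j u).
Hypothesis B_mono : forall j u v, u <= v -> B j u `<=` B j v.
Hypothesis B0 : forall j, B j 0 = set0.
Hypothesis B_inc : forall j (u v : R), 0 <= u -> u <= v ->
  law_mass X0 (B j v `\` B j u) <= v - u.
Implicit Types (u v : 'I_m -> R) (c : 'I_m -> nat) (A : set E).

Local Notation mass := (law_mass X0).
Local Notation dev := (deviation X0 X).
Let nR_gt0 : 0 < n%:R :> R. Proof. by rewrite ltr0n. Qed.

Definition union_at u : set E := [set z | exists j, B j (u j) z].

Lemma measurable_union_at u : measurable (union_at u).
Proof.
have -> : union_at u = \bigcup_(j in [set: 'I_m]) B j (u j).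
  by apply/seteqP; split => [z [j ?]|z [j _ ?]]; exists j.
by apply: fin_bigcup_measurable => // j _; exact: mB.
Qed.

Lemma union_at_mono u v : (forall j, u j <= v j) -> union_at u `<=` union_at v.
Proof. by move=> uv z [j Bz]; exists j; apply: B_mono Bz. Qed.

Lemma mass_union_atD u v : (forall j, 0 <= u j) -> (forall j, u j <= v j) ->
  mass (union_at v `\` union_at u) <= \sum_j (v j - u j).
Proof.
move=> u0 uv; apply: le_trans (_ : \sum_j mass (B j (v j) `\` B j (u j)) <= _); last first.
  by apply: ler_sum => j _; exact: B_inc.
apply: fine_prob_union_bound.
- by apply: measurableD; exact: measurable_union_at.
- by move=> j; apply: measurableD; exact: mB.
- by move=> z [[j Bz] nz]; exists j => //; split=> // Bu; apply: nz; exists j.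
Qed.

Lemma hits_mono A A' w : A `<=` A' -> hits X A w \subset hits X A' w.
Proof.
by move=> AA; apply/fintype.subsetP => i; rewrite !mem_hits => /asboolP /AA /asboolP.
Qed.

Lemma deviation_setD A A' w : measurable A -> measurable A' -> A `<=` A' ->
  dev A' w = dev A w + dev (A' `\` A) w.
Proof.
move=> mA mA' AA; rewrite /deviation /law_mass fine_probD//.
rewrite -(cardsID (hits X A w) (hits X A' w)).
have /finset.setIidPr -> := hits_mono w AA.
have -> : (hits X A' w :\: hits X A w)%SET = hits X (A' `\` A) w.
  apply/setP => i; rewrite finset.in_setD !mem_hits.
  by rewrite -asbool_neg -asbool_and; apply: asbool_equiv_eq; rewrite /setD/=; tauto.
by rewrite natrD; ring.
Qed.

Lemma deviation_set0 w : dev set0 w = 0.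
Proof.
rewrite /deviation /law_mass measure0 mulr0 subr0.
suff -> : hits X set0 w = finset.set0 by rewrite cards0.
by apply/setP => i; rewrite mem_hits inE; apply/asboolPn.
Qed.

Lemma deviation_sandwich A A' A'' w e : measurable A -> measurable A' ->
  measurable A'' -> A `<=` A' -> A' `<=` A'' ->
  `|dev A w| <= e -> `|dev A'' w| <= e ->
  `|dev A' w| <= e + n%:R * mass (A'' `\` A).
Proof.
move=> mA mA' mA'' s1 s2; rewrite /law_mass fine_probD//; last exact: subset_trans s2.
have : n%:R * mass A <= n%:R * mass A'.
  by rewrite ler_pM2l// le_fine_prob.
have : n%:R * mass A' <= n%:R * mass A''.
  by rewrite ler_pM2l// le_fine_prob.
have : (#|hits X A w|%:R : R) <= #|hits X A' w|%:R.
  by rewrite ler_nat subset_leq_card// hits_mono.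
have : (#|hits X A' w|%:R : R) <= #|hits X A'' w|%:R.
  by rewrite ler_nat subset_leq_card// hits_mono.
rewrite !ler_norml /deviation mulrBr /law_mass; lra.
Qed.

(** A grid point at mesh [a / 2^r] is given by its integer coordinates; its
    parent is the point of the mesh [a / 2^(r-1)] just below it, in the same
    integer coordinates.  At [r = 0] the parent is the origin, where the union
    is empty, so that the coarsest level is not a special case. *)
Definition grid (a : R) r c (j : 'I_m) : R := a * (c j)%:R / 2 ^+ r.
Definition parent c (j : 'I_m) : nat := (c j)./2.*2.
Definition half c (j : 'I_m) : nat := (c j)./2.
Definition chain_step a r c : set E :=
  union_at (grid a r c) `\` union_at (grid a r (parent c)).

Lemma grid_parent a r c : grid a r.+1 (parent c) = grid a r (half c).
Proof.
apply/funext => j; rewrite /grid /parent /half -muln2 natrM exprS.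
have : (2 ^+ r : R) != 0 by rewrite expf_neq0.
by move=> h; field.
Qed.

Lemma parent_le c j : (parent c j <= c j <= (parent c j).+1)%N.
Proof. by rewrite /parent; have := odd_double_half (c j); case: odd; lia. Qed.

Lemma grid_parent_le a r c j : 0 <= a ->
  grid a r (parent c) j <= grid a r c j.
Proof.
move=> a0; rewrite /grid ler_pM2r ?invr_gt0 ?exprn_gt0// ler_wpM2l// ler_nat.
by case/andP: (parent_le c j).
Qed.

Lemma grid_ge0 a r c j : 0 <= a -> 0 <= grid a r c j.
Proof. by move=> a0; rewrite /grid !mulr_ge0// invr_ge0 exprn_ge0. Qed.

Lemma measurable_chain_step a r c : measurable (chain_step a r c).
Proof. by apply: measurableD; exact: measurable_union_at. Qed.

Lemma mass_chain_step a r c : 0 <= a ->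
  mass (chain_step a r c) <= m%:R * a / 2 ^+ r.
Proof.
move=> a0; apply: le_trans (mass_union_atD _ _) _.
- by move=> j; exact: grid_ge0.
- by move=> j; exact: grid_parent_le.
have -> : m%:R * a / 2 ^+ r = \sum_(j < m) a / 2 ^+ r.
  by rewrite big_const_ord iter_addr_0 -[RHS]mulr_natl mulrA.
apply: ler_sum => j _; rewrite /grid -mulrBl ler_pM2r ?invr_gt0 ?exprn_gt0//.
rewrite -mulrBr ler_piMr// lerBlDr nat1r ler_nat.
by case/andP: (parent_le c j).
Qed.

Definition chained (a : R) (t : nat -> R) r0 (w : Omega) : Prop :=
  forall r c, (r <= r0)%N -> (forall j, (c j <= 2 ^ r)%N) ->
    `|dev (chain_step a r c) w| <= t r.

Lemma grid_deviation a t r0 w : 0 <= a -> chained a t r0 w ->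
  forall r c, (r <= r0)%N -> (forall j, (c j <= 2 ^ r)%N) ->
  `|dev (union_at (grid a r c)) w| <= \sum_(i < r.+1) t i.
Proof.
move=> a0 good; have step r c : (r <= r0)%N -> (forall j, (c j <= 2 ^ r)%N) ->
    `|dev (union_at (grid a r c)) w| <=
    `|dev (union_at (grid a r (parent c))) w| + t r.
  move=> rr cr; rewrite (deviation_setD w (measurable_union_at (grid a r (parent c)))).
  - by apply: le_trans (ler_normD _ _) _; rewrite lerD2l; exact: good.
  - exact: measurable_union_at.
  - by apply: union_at_mono => j; exact: grid_parent_le.
elim=> [|r IH] c rr cr; apply: le_trans (step _ _ rr cr) _; rewrite big_ord_recr/=.
  rewrite big_ord0 (_ : union_at _ = set0) ?deviation_set0 ?normr0//.
  apply/seteqP; split => // z [j]; rewrite /grid /parent.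
  have := cr j; rewrite expn0 => cj; have -> : ((c j)./2).*2 = 0%N by lia.
  by rewrite mulr0 mul0r B0.
rewrite lerD2r grid_parent; apply: IH; first exact: ltnW.
by move=> j; rewrite /half; have := cr j; rewrite expnS; lia.
Qed.

(** Between two neighbouring points of the finest grid the count is monotone, so
    arbitrary levels cost only the mass between these two points. *)
Lemma chained_deviation a t r0 w u : 0 < a -> chained a t r0 w ->
  (forall j, 0 <= u j <= a) ->
  `|dev (union_at u) w| <= \sum_(i < r0.+1) t i + n%:R * (m%:R * a / 2 ^+ r0).
Proof.
move=> a0 good ua; have p2 : 0 < 2 ^+ r0 :> R by rewrite exprn_gt0.
pose c j := Num.truncn (u j / a * 2 ^+ r0).
(* The cap matters for u j = a, whose upper neighbour would leave the grid. *)
pose c' j := minn (c j).+1 (2 ^ r0).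
have x0 j : 0 <= u j / a * 2 ^+ r0.
  have /andP[? _] := ua j; rewrite !mulr_ge0// ?invr_ge0 ?ltW//.
have lc j : (c j)%:R <= u j / a * 2 ^+ r0 by rewrite truncn_le.
have cl j : (c j <= 2 ^ r0)%N.
  rewrite -(ler_nat R) natrX; apply: le_trans (lc j) _.
  by apply: ler_piMl (ltW p2) _; rewrite ler_pdivrMr// mul1r; case/andP: (ua j).
have g1 j : grid a r0 c j <= u j.
  rewrite /grid ler_pdivrMr// mulrC -ler_pdivlMr//.
  by rewrite mulrAC.
have g2 j : u j <= grid a r0 c' j.
  rewrite /grid /c' /minn; case: ifPn => _.
    rewrite ler_pdivlMr// [a * _]mulrC -ler_pdivrMr// mulrAC ltW//.
    by have /andP[] := truncn_itv (x0 j).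
  by rewrite natrX mulfK ?gt_eqF//; case/andP: (ua j).
have c'l j : (c' j <= 2 ^ r0)%N by rewrite geq_minr.
have mU := measurable_union_at.
apply: le_trans (deviation_sandwich (mU (grid a r0 c)) (mU u) (mU (grid a r0 c')) _ _
  (grid_deviation (ltW a0) good (leqnn _) cl)
  (grid_deviation (ltW a0) good (leqnn _) c'l)) _.
- exact: union_at_mono.
- exact: union_at_mono.
rewrite lerD2l ler_pM2l//; apply: le_trans (mass_union_atD _ _) _.
- by move=> j; apply: grid_ge0; exact: ltW.
- by move=> j; apply: le_trans (g1 j) (g2 j).
have -> : m%:R * a / 2 ^+ r0 = \sum_(j < m) a / 2 ^+ r0.
  by rewrite big_const_ord iter_addr_0 -[RHS]mulr_natl mulrA.
apply: ler_sum => j _; rewrite /grid -mulrBl ler_pM2r ?invr_gt0//.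
by rewrite -mulrBr; apply: ler_piMr (ltW a0) _; rewrite lerBlDr nat1r ler_nat /c' geq_minl.
Qed.

(** Union bound over the grid points of all levels, [(2^r + 1)^m] at level [r]. *)
Lemma prob_unchained (a : R) (t la : nat -> R) r0 : 0 < a ->
  (forall r, (r <= r0)%N -> 0 < la r <= 1 / 2) ->
  exists G : set Omega, [/\ measurable G,
    fine (P (~` G)) <= \sum_(r < r0.+1) (2 ^+ r.+1) ^+ m *
      (2 * expR (2 * la r ^+ 2 * (n%:R * (m%:R * a / 2 ^+ r)) - la r * t r)) &
    forall w, G w -> chained a t r0 w].
Proof.
move=> a0 hla.
pose cell r (f : {ffun 'I_m -> 'I_(2 ^ r).+1}) : set Omega :=
  [set w | t r < `|dev (chain_step a r (fun j => f j)) w|].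
pose bad r := \bigcup_(f in [set: {ffun 'I_m -> 'I_(2 ^ r).+1}]) cell r f.
have mcell r f : measurable (cell r f).
  exact: (measurable_hits X
    (fun J => t r < `|#|J|%:R - n%:R * mass (chain_step a r (fun j => f j))|)
    (measurable_chain_step a r (fun j => f j))).
have mbad r : measurable (bad r) by apply: fin_bigcup_measurable.
have mG : measurable (\bigcup_(r in [set: 'I_r0.+1]) bad r).
  by apply: fin_bigcup_measurable.
exists (~` \bigcup_(r in [set: 'I_r0.+1]) bad r); split; first exact: measurableC.
- rewrite setCK; apply: le_trans (_ : \sum_(r < r0.+1) fine (P (bad r)) <= _).
    exact: (@fine_prob_union_bound _ _ _ P _ _ (fun r : 'I_r0.+1 => bad r)).
  apply: ler_sum => r _.
  apply: le_trans (_ : \sum_f fine (P (cell r f)) <= _).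
    exact: (@fine_prob_union_bound _ _ _ P _ _ (cell r)).
  apply: le_trans (_ : \sum_(f : {ffun 'I_m -> 'I_(2 ^ r).+1})
      2 * expR (2 * la r ^+ 2 * (n%:R * (m%:R * a / 2 ^+ r)) - la r * t r) <= _).
    apply: ler_sum => f _; apply: (two_sided_chernoff iidX).
    - exact: measurable_chain_step.
    - by apply: hla; rewrite -ltnS.
    - by rewrite ler_pM2l//; apply: mass_chain_step; exact: ltW.
  rewrite sumr_const card_ffun !card_ord -[leLHS]mulr_natl.
  rewrite ler_wpM2r ?mulr_ge0 ?expR_ge0// natrX lerXn2r ?nnegrE ?exprn_ge0//.
  by rewrite -natrX ler_nat expnS; have := expn_gt0 2 r; lia.
- move=> w nb r c rr cr; rewrite leNgt; apply/negP => h; apply: nb.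
  exists (Ordinal (rr : (r < r0.+1)%N)) => //=.
  exists [ffun j => inord (c j)] => //; rewrite /cell /=.
  rewrite (_ : (fun j => _) = c)//; apply/funext => j.
  by rewrite ffunE inordK// ltnS.
Qed.

(** The threshold decays geometrically, so that the thresholds sum up to a
    multiple of [m sqrt (N s)]; the tilt minimises the Chernoff exponent for
    this threshold and the variance [m N / 2^r].  The exponent is then
    [- 18 m s (9/8)^r], with [9/8 = 2 (3/4)^2] from the halving of the variance
    against the decay of the squared threshold. *)
Definition level_tilt (N s : R) r : R := 3 * (3 / 2) ^+ r * (Num.sqrt (N * s) / N).
Definition level_threshold (N s : R) r : R :=
  12 * m%:R * Num.sqrt (N * s) * (3 / 4) ^+ r.

(** The exponent [18 m s (9/8)^r] dominates [s + 2 (r + 1) m] by Bernoulli's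
    inequality; as [exp 2 >= 4], this beats the [2^((r+1)m)] grid points and
    leaves a geometric series in [r]. *)
Lemma level_tail (N s : R) r : (0 < m)%N -> 1 <= s -> 36 * s <= N ->
  (2 ^+ r.+1) ^+ m *
    (2 * expR (2 * level_tilt N s r ^+ 2 * (n%:R * (m%:R * (N / n%:R) / 2 ^+ r))
               - level_tilt N s r * level_threshold N s r))
  <= expR (- s) * (1 / 2) ^+ r.
Proof.
rewrite /level_tilt /level_threshold => m0 s1 sN; set Q := Num.sqrt (N * s).
set la := 3 * (3 / 2) ^+ r * (Q / N); set t := 12 * m%:R * Q * (3 / 4) ^+ r.
have N0 : 0 < N by lra.
have QQ : Q ^+ 2 = N * s by rewrite sqr_sqrtr// mulr_ge0//; lra.
have m1 : 1 <= m%:R :> R by rewrite ler1n.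
have -> : 2 * la ^+ 2 * (n%:R * (m%:R * (N / n%:R) / 2 ^+ r)) - la * t =
    - (18 * m%:R * s * (9 / 8) ^+ r).
  have -> : 2 * la ^+ 2 * (n%:R * (m%:R * (N / n%:R) / 2 ^+ r)) =
      18 * (Q ^+ 2 / N) * m%:R * ((3 / 2) ^+ r * (3 / 2) ^+ r / 2 ^+ r).
    rewrite /la; have := lt0r_neq0 N0; have := lt0r_neq0 nR_gt0.
    have : (2 ^+ r : R) != 0 by rewrite expf_neq0.
    by move=> *; field; apply/and3P.
  have -> : la * t = 36 * (Q ^+ 2 / N) * m%:R * ((3 / 2) ^+ r * (3 / 4) ^+ r).
    by rewrite /la /t; have := lt0r_neq0 N0; move=> *; field.
  rewrite -exprMn -exprVn -!exprMn QQ.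
  rewrite (_ : (3 / 2 * (3 / 2) / 2) = 9 / 8 :> R); last by field.
  rewrite (_ : (3 / 2 * (3 / 4)) = 9 / 8 :> R); last by field.
  by have := lt0r_neq0 N0; move=> *; field.
have bern : 1 + r%:R * (1 / 8) <= (9 / 8) ^+ r :> R.
  by have -> : 9 / 8 = 1 + 1 / 8 :> R; [lra | apply: bernoulli_ge; lra].
have r0 : 0 <= r%:R :> R by [].
have ms : s <= m%:R * s by nra.
have mm : m%:R <= m%:R * s by nra.
have key : s + 2 * (r.+1%:R * m%:R) <= 18 * m%:R * s * (9 / 8) ^+ r.
  apply: le_trans (_ : 18 * m%:R * s * (1 + r%:R * (1 / 8)) <= _); last first.
    by apply: ler_wpM2l bern; nra.
  by rewrite -natr1; have := ler_wpM2l r0 mm; nra.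
apply: le_trans (_ : (2 ^+ r.+1) ^+ m * (2 * (expR (- s) * (expR 2 ^- (r.+1 * m)))) <= _).
  rewrite ler_wpM2l ?exprn_ge0// ler_wpM2l//.
  by rewrite -expRM_natl -expRN -expRD ler_expR natrM; lra.
rewrite -exprM.
have -> x y : x * (2 * (expR (- s) * y)) = expR (- s) * (2 * (x * y)) by ring.
rewrite ler_wpM2l ?expR_ge0//.
apply: le_trans (_ : 2 * (2 ^+ (r.+1 * m) * 4 ^- (r.+1 * m)) <= _).
  rewrite ler_wpM2l// ler_wpM2l ?exprn_ge0// lef_pV2 ?posrE ?exprn_gt0 ?expR_gt0//.
  by rewrite lerXn2r ?nnegrE ?expR_ge0// expR2_ge4.
rewrite -exprVn -exprMn (_ : 2 / 4 = 1 / 2 :> R); last by field.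
apply: le_trans (_ : 2 * (1 / 2) ^+ r.+1 <= _); last first.
  by rewrite exprS mulrA (_ : 2 * (1 / 2) = 1 :> R) ?mul1r//; field.
rewrite ler_wpM2l//; apply: ler_wiXn2l; [lra|lra|].
by rewrite leq_pmulr.
Qed.

(** The thresholds [12 m Q (3/4)^r] add up to at most [48 m Q], and stopping the
    refinement costs another [12 m Q], where [Q = sqrt (N s)]. *)
Lemma uniform_deviation (N s : R) : (0 < m)%N -> 1 <= s -> 36 * s <= N ->
  exists G : set Omega, [/\ measurable G,
    fine (P (~` G)) <= 2 * expR (- s) &
    forall w, G w -> forall u, (forall j, 0 <= u j <= N / n%:R) ->
      `|dev (union_at u) w| <= 60 * m%:R * Num.sqrt (N * s)].
Proof.
move=> m0 s1 sN; set Q := Num.sqrt (N * s).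
have N0 : 0 < N by lra.
have Q0 : 0 < Q by rewrite sqrtr_gt0 mulr_gt0//; lra.
have QQ : Q * Q = N * s by rewrite -expr2 sqr_sqrtr// mulr_ge0//; lra.
have QN : 6 * Q <= N by nra.
(* The finest level: the lower bound on N / (6 Q) keeps the tilts at most 1/2,
   the upper one makes the mesh term m N / 2^r0 at most 12 m Q. *)
have [|r0 /andP[lo hi]] := @dyadic_scale _ (N / (6 * Q)).
  by rewrite ler_pdivlMr ?mul1r//; lra.
have a0 : 0 < N / n%:R by rewrite divr_gt0.
have hla r : (r <= r0)%N -> 0 < level_tilt N s r <= 1 / 2.
  rewrite /level_tilt -/Q => rr; apply/andP; split.
    by rewrite !mulr_gt0 ?exprn_gt0 ?invr_gt0//; lra.
  have : (3 / 2) ^+ r <= N / (6 * Q).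
    apply: le_trans lo; apply: le_trans (_ : 2 ^+ r <= _).
      by rewrite lerXn2r ?nnegrE//; lra.
    by rewrite ler_weXn2l//; lra.
  rewrite ler_pdivlMr; last lra.
  by move=> h; rewrite mulrA ler_pdivrMr//; lra.
have [G [mG PG good]] := prob_unchained (level_threshold N s) a0 hla.
exists G; split => //.
  apply: le_trans PG _.
  apply: le_trans (_ : \sum_(r < r0.+1) expR (- s) * (1 / 2) ^+ r <= _).
    by apply: ler_sum => r _; exact: level_tail.
  rewrite -mulr_sumr mulrC ler_wpM2r ?expR_ge0//.
  apply: le_trans (geometric_sum_le _ _) _; first by lra.
  by rewrite (_ : (1 - 1 / 2)^-1 = 2 :> R)//; field.
move=> w Gw u hu; apply: le_trans (chained_deviation a0 (good _ Gw) hu) _.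
rewrite -mulr_sumr.
have h34 : 0 <= (3 / 4 : R) < 1 by lra.
have := geometric_sum_le r0.+1 h34; rewrite (_ : (1 - 3 / 4)^-1 = 4 :> R); last by field.
have m1 : 1 <= m%:R :> R by rewrite ler1n.
have mQ : 0 <= 12 * m%:R * Q by rewrite !mulr_ge0// ltW.
move=> /(ler_wpM2l mQ) h.
have -> : n%:R * (m%:R * (N / n%:R) / 2 ^+ r0) = m%:R * (N / 2 ^+ r0).
  have := lt0r_neq0 nR_gt0; have : (2 ^+ r0 : R) != 0 by rewrite expf_neq0.
  by move=> *; field; apply/andP.
have : N / 2 ^+ r0 <= 12 * Q.
  move: hi; rewrite ler_pdivrMr ?exprn_gt0// ltr_pdivrMr ?mulr_gt0// exprS => /ltW.
  by rewrite (_ : 2 * _ * _ = 12 * Q * 2 ^+ r0); last by ring.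
move=> /(ler_wpM2l (ltW (lt_le_trans ltr01 m1))) h'; apply: le_trans (lerD h h') _.
by rewrite le_eqVlt; apply/orP; left; apply/eqP; ring.
Qed.

End uniform_deviation.

(** * Tail sets of continuous margins *)

Section tail_sets.
Context (disp : measure_display) (Omega : measurableType disp) (R : realType)
  (P : probability Omega R) (d : nat) (X0 : {RV P >-> d.-tuple R}).
Hypothesis margin_continuous : forall j, continuous (margin_cdf X0 j).

Local Notation F := (margin_cdf X0).
Local Notation mass := (law_mass X0).

Definition tail_set (j : 'I_d) (u : R) : set (d.-tuple R) :=
  [set z | (survival_inv (F j) u < (tnth z j)%:E)%E].

Lemma tail_setE j u : tail_set j u =
  (fun z : d.-tuple R => tnth z j) @^-1` [set y | (survival_inv (F j) u < y%:E)%E].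
Proof. by []. Qed.

Lemma measurable_tail_set j u : measurable (tail_set j u).
Proof.
rewrite tail_setE -[_ @^-1` _]setTI; apply: measurable_tnth => //.
case: (survival_inv (F j) u) => [r| |].
- rewrite (_ : [set _ | _] = `]r, +oo[%classic) ?measurable_itv//.
  by apply/seteqP; split => y; rewrite /= lte_fin in_itv/= andbT.
- by rewrite (_ : [set _ | _] = set0)//; apply/seteqP; split => y.
- by rewrite (_ : [set _ | _] = setT)//; apply/seteqP; split => y //= _; exact: ltNyr.
Qed.

Lemma survival_inv_antitone (G : R -> R) (u v : R) : u <= v ->
  (survival_inv G v <= survival_inv G u)%E.
Proof.
move=> uv; apply: le_ereal_sup => _ [y /= vy <-]; exists y => //=.
exact: le_trans uv vy.
Qed.

Lemma tail_set_mono j u v : u <= v -> tail_set j u `<=` tail_set j v.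
Proof. by move=> uv z; apply: le_lt_trans; exact: survival_inv_antitone. Qed.

Lemma margin_cdfE j r : F j r = fine (P [set w | coordinate X0 j w <= r]).
Proof.
by rewrite /margin_cdf /cdf /distribution /pushforward set_itvE.
Qed.

Lemma measurable_coordinate_le j (r : R) : measurable [set w | coordinate X0 j w <= r].
Proof.
rewrite (_ : [set w | _] = coordinate X0 j @^-1` `]-oo, r]%classic); last first.
  by apply/seteqP; split => w; rewrite /= in_itv.
by rewrite -[_ @^-1` _]setTI; apply: measurable_coordinate => //; exact: measurable_itv.
Qed.

Lemma margin_cdf_le1 j r : F j r <= 1.
Proof. by rewrite margin_cdfE; apply: fine_prob_le1; exact: measurable_coordinate_le. Qed.

Lemma mass_gt j (r : R) : mass [set z | (r%:E < (tnth z j)%:E)%E] = 1 - F j r.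
Proof.
rewrite margin_cdfE -fine_probC; last exact: measurable_coordinate_le.
rewrite /law_mass /distribution /pushforward; congr (fine (P _)).
by apply/seteqP; split => w /=; rewrite lte_fin ltNge => /negP.
Qed.

Lemma survival_inv0 j : survival_inv (F j) 0 = +oo%E.
Proof.
apply: hasNub_ereal_sup; last first.
- by exists 0 => /=; rewrite subr_ge0 margin_cdf_le1.
- move=> [M hM]; have : M + 1 <= M by apply: hM => /=; rewrite subr_ge0 margin_cdf_le1.
by lra.
Qed.

Lemma tail_set0 j : tail_set j 0 = set0.
Proof. by apply/seteqP; split => // z; rewrite /tail_set /= survival_inv0. Qed.

Lemma tail_set_NyE j u : survival_inv (F j) u = -oo%E -> tail_set j u = setT.
Proof.
by move=> h; apply/seteqP; split => // z _; rewrite /tail_set /= h ltNyr.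
Qed.

Lemma margin_cdf_ge0 j r : 0 <= F j r.
Proof. by rewrite margin_cdfE fine_prob_ge0. Qed.

Lemma tail_set_gt1 j u : 1 < u -> tail_set j u = setT.
Proof.
move=> u1; apply: tail_set_NyE; rewrite /survival_inv.
rewrite (_ : [set y | _] = set0) ?image_set0 ?ereal_sup0//.
apply/seteqP; split => // y /=; have := margin_cdf_ge0 j y; lra.
Qed.

Lemma margin_cdf_cvgNy0 j : F j y @[y --> -oo] --> (0 : R).
Proof. exact: (fine_cvg (cvg_cdfNy0 (coordinate X0 j : {RV P >-> R}))). Qed.

Lemma margin_cdf_cvgy1 j : F j y @[y --> +oo] --> (1 : R).
Proof. exact: (fine_cvg (cvg_cdfy1 (coordinate X0 j : {RV P >-> R}))). Qed.

(** The generalized inverse is attained: continuity from the left keeps the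
    supremum inside [1 - F >= u], and continuity from the right excludes
    [1 - F > u] there. *)
Lemma margin_cdf_sup j u : 0 < u -> [set y | u <= 1 - F j y] !=set0 ->
  exists2 s, survival_inv (F j) u = s%:E & F j s = 1 - u.
Proof.
move=> u0 S0; set S := [set y | _] in S0 *.
have ubS : has_ubound S.
  have : \forall y \near +oo, 1 - u < F j y.
    by apply: (cvgr_gt _ (@margin_cdf_cvgy1 j)); lra.
  move=> [M [_ hM]]; exists M => y /=; rewrite /S /= => Sy.
  by rewrite leNgt; apply/negP => /hM; lra.
have supS : has_sup S by split.
exists (sup S); first by rewrite /survival_inv ereal_sup_EFin.
have ctn : F j y @[y --> sup S] --> F j (sup S) by exact: margin_continuous.
apply/eqP; rewrite eq_le; apply/andP; split; rewrite leNgt; apply/negP => h.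
- have : \forall y \near sup S, 1 - u < F j y by exact: (cvgr_gt _ ctn).
  move=> /nbhs_ballP[e /= e0 he]; have [y Sy ye] := sup_adherent e0 supS.
  have ys := ub_le_sup ubS Sy.
  have : 1 - u < F j y by apply: he; rewrite /ball/= ltr_distlC; lra.
  by move: Sy; rewrite /S /=; lra.
- have : \forall y \near sup S, F j y < 1 - u by exact: (cvgr_lt _ ctn).
  move=> /nbhs_ballP[e /= e0 he].
  have : F j (sup S + e / 2) < 1 - u by apply: he; rewrite /ball/= ltr_distlC; lra.
  move=> h'; have : sup S + e / 2 <= sup S by apply: ub_le_sup => //; rewrite /S /=; lra.
  by lra.
Qed.

Lemma mass_tail_set j u : 0 <= u -> mass (tail_set j u) = Num.min u 1.
Proof.
move=> u0; have [<-|un0] := eqVneq 0 u.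
  by rewrite tail_set0 /law_mass measure0 min_l.
have {un0}u0' : 0 < u by rewrite lt_neqAle un0.
(* If no y satisfies u <= 1 - F y, the inverse is -oo, and F -> 0 at -oo
   forces 1 <= u. *)
have [S0|/set0P S0] := eqVneq [set y | u <= 1 - F j y] set0.
  rewrite tail_set_NyE; last by rewrite /survival_inv S0 image_set0 ereal_sup0.
  rewrite /law_mass probability_setT min_r// leNgt; apply/negP => u1.
  have : \forall y \near -oo, F j y < 1 - u.
    by apply: (cvgr_lt _ (@margin_cdf_cvgNy0 j)); lra.
  move=> [M [_ hM]]; have h : F j (M - 1) < 1 - u by apply: hM; lra.
  have : [set y | u <= 1 - F j y] (M - 1) by rewrite /=; lra.
  by rewrite S0.
have [s sE Fs] := margin_cdf_sup u0' S0.
rewrite /tail_set sE mass_gt Fs min_l; first by lra.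
by have := margin_cdf_ge0 j s; lra.
Qed.

Lemma mass_tail_setD j u v : 0 <= u -> u <= v ->
  mass (tail_set j v `\` tail_set j u) <= v - u.
Proof.
move=> u0 uv; rewrite /law_mass fine_probD; last 3 first.
- exact: measurable_tail_set.
- exact: measurable_tail_set.
- exact: tail_set_mono.
rewrite -!/(law_mass _ _) !mass_tail_set//; last lra.
by rewrite /Num.min; do !case: ifPn; rewrite -?leNgt; lra.
Qed.

Lemma FtildeE (u : 'I_d -> R) : Ftilde X0 u = mass (union_at tail_set u).
Proof.
have mU := measurable_union_at measurable_tail_set u.
rewrite /Ftilde /joint_cdf -[mass _](opprK) -[LHS]opprK opprB; congr (- _).
transitivity (mass (~` union_at tail_set u) - 1); last first.
  by rewrite /law_mass fine_probC//; lra.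
congr (fine (P _) - 1); apply/seteqP; split => w /= h.
  by move=> [j]; rewrite /tail_set/= ltNge => /negP; apply; exact: h.
by move=> j; rewrite leNgt; apply/negP => hj; apply: h; exists j.
Qed.

End tail_sets.

(** * The estimator through ranks *)

Section ranks.
Context (R : realType) (n : nat).

Lemma order_stat_le (z : 'I_n -> R) (r : int) (i : 'I_n) :
  (order_stat z r <= (z i)%:E)%E = (r <= #|[pred i' | z i' <= z i]|%:Z).
Proof.
rewrite /order_stat; case: r => [[|p]|p] /=; rewrite ?leNye//.
have -> : #|[pred i' | z i' <= z i]| = count (<= z i) (sort <=%R [seq z i' | i' : 'I_n]).
  rewrite count_sort /image_mem count_map cardE enumT.
  by rewrite {1}/enum_mem size_filter.
set s := sort _ _; have ss : sorted <=%R s by apply: sort_sorted; exact: le_total.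
rewrite lez_nat; have [ps|sp] := ltnP p (size s); last first.
  rewrite nth_default ?size_map//; apply/esym/negbTE; rewrite -ltnNge ltnS.
  exact: leq_trans (count_size _ _) sp.
rewrite (nth_map 0)// lee_fin; have [h|h] := ltnP p (count (<= z i) s).
  exact: (nth_count_le _ ss h).
apply/negbTE; rewrite -ltNge; apply: nth_count_gt => //.
by rewrite h.
Qed.

Definition num_above (z : 'I_n -> R) (i : 'I_n) : nat := #|[pred i' | z i < z i']|.

(** This form absorbs all boundary cases: the infinite order statistics
    correspond to [p <= 0] and [p > n]. *)
Lemma order_stat_num_above (z : 'I_n -> R) (p : int) (i : 'I_n) :
  (order_stat z (n%:Z - p + 1) <= (z i)%:E)%E = ((num_above z i)%:Z < p).
Proof.
rewrite order_stat_le.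
have : (#|[pred i' | (z i' <= z i)%R]| + num_above z i = n)%N.
  rewrite -[RHS](card_ord n) -(cardC [pred i' | (z i' <= z i)%R]); congr addn.
  by apply: eq_card => i'; rewrite !inE -ltNge.
lia.
Qed.

Lemma emp_stdfE (d k : nat) (z : 'I_n -> d.-tuple R) (x : 'I_d -> R) :
  emp_stdf k z x = k%:R^-1 * #|[pred i | [exists j : 'I_d,
    (num_above (fun i' => tnth (z i') j) i)%:Z < Num.floor (k%:R * x j)]]|%:R.
Proof.
rewrite /emp_stdf; congr (_ * _); rewrite -natr_sum; congr (_%:R).
rewrite -sum1_card [RHS]big_mkcond /=; apply: eq_bigr => i _.
rewrite (eq_existsb (P2 := fun j =>
    (num_above (fun i' => tnth (z i') j) i)%:Z < Num.floor (k%:R * x j))).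
  have natb (b : bool) : nat_of_bool b = if b then 1%N else 0%N by case: b.
  by rewrite inE; exact: natb.
by move=> j; exact: order_stat_num_above.
Qed.

End ranks.

(** * Measurability of events about the estimator *)

Section measurability.
Context (disp : measure_display) (Omega : measurableType disp).

(** [S] is the finite union of the fibres of [f] that it meets. *)
Lemma measurable_saturated (I : finType) (f : Omega -> I) (S : set Omega) :
  (forall h, measurable (f @^-1` [set h])) ->
  (forall w w', f w = f w' -> S w -> S w') -> measurable S.
Proof.
move=> mf sat; rewrite (_ : S = \bigcup_(h in f @` S) (f @^-1` [set h])).
  by apply: fin_bigcup_measurable => //; exact: finite_finset.
apply/seteqP; split => [w Sw|w [_ [w' Sw' <-]] /= h].
  by exists (f w) => //; exists w.
exact: sat Sw'.
Qed.

Context (R : realType) (P : probability Omega R) (d n k : nat)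
  (X : 'I_n -> {RV P >-> d.-tuple R}).

Definition comparisons (w : Omega) : {ffun 'I_d * 'I_n * 'I_n -> bool} :=
  [ffun t => tnth (X t.1.2 w) t.1.1 < tnth (X t.2 w) t.1.1].

Lemma measurable_comparisons h : measurable (comparisons @^-1` [set h]).
Proof.
rewrite (_ : _ @^-1` _ = \bigcap_(t in [set: 'I_d * 'I_n * 'I_n])
  ((fun w => coordinate (X t.1.2) t.1.1 w < coordinate (X t.2) t.1.1 w) @^-1` [set h t])).
  apply: fin_bigcap_measurable => // t _; rewrite -[_ @^-1` _]setTI.
  by apply: measurable_fun_ltr => //; exact: measurable_coordinate.
apply/seteqP; split => [w /= <- t _ /=|w /= hw]; first by rewrite ffunE.
by apply/ffunP => t; rewrite ffunE; exact: hw.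
Qed.

Lemma emp_stdf_comparisons w w' x : comparisons w = comparisons w' ->
  emp_stdf k (fun i => X i w) x = emp_stdf k (fun i => X i w') x.
Proof.
move=> ww; rewrite !emp_stdfE; congr (_ * _%:R); apply: eq_card => i; rewrite !inE.
apply: eq_existsb => j; congr (_%:Z < _); apply: eq_card => i'; rewrite !inE.
by have /ffunP/(_ (j, i, i')) := ww; rewrite !ffunE.
Qed.

Lemma measurable_emp_stdf_event (T : R) (g : ('I_d -> R) -> R) (c : \bar R) :
  measurable [set w | (box_sup T (fun x =>
    `|emp_stdf k (fun i => X i w) x - g x|%R) <= c)%E].
Proof.
apply: (measurable_saturated measurable_comparisons) => w w' ww /=.
by under [X in _ -> (box_sup _ X <= _)%E]eq_fun do rewrite -(emp_stdf_comparisons _ ww).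
Qed.

End measurability.

(** * Sandwiching the estimator between tail set counts *)

Section estimator.
Context (disp : measure_display) (Omega : measurableType disp) (R : realType)
  (P : probability Omega R) (d : nat) (X0 : {RV P >-> d.-tuple R}).
Context (n : nat) (X : 'I_n -> {RV P >-> d.-tuple R}).
Hypothesis margin_continuous : forall j, continuous (margin_cdf X0 j).
Hypothesis n_gt0 : (0 < n)%N.
Hypothesis iidX : iid_sample X0 X.

Local Notation A := (tail_set X0).
Local Notation rank_above w j := (num_above (fun i' => tnth (X i' w) j)).

(** Whatever lies above a point of a tail set is in that tail set too. *)
Lemma num_above_tail_set j u w i (p : int) : #|hits X (A j u) w|%:Z < p ->
  A j u (X i w) -> (rank_above w j i)%:Z < p.
Proof.
move=> hp Ai; apply: le_lt_trans hp; rewrite lez_nat.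
apply: subset_leq_card; apply/fintype.subsetP => i'; rewrite mem_hits inE => lt_i.
by apply/asboolP; apply: lt_trans Ai _; rewrite lte_fin.
Qed.

(** Every point of a tail set lies above every point outside it. *)
Lemma tail_set_num_above j u w i (p : int) : p <= #|hits X (A j u) w|%:Z ->
  (rank_above w j i)%:Z < p -> A j u (X i w).
Proof.
move=> hp; apply: contraPP => /negP; rewrite -leNgt => le_i.
apply/negP; rewrite -leNgt; apply: le_trans hp _; rewrite lez_nat.
apply: subset_leq_card; apply/fintype.subsetP => i'; rewrite mem_hits => /asboolP Ai'.
by rewrite inE -lte_fin; apply: le_lt_trans le_i Ai'.
Qed.

(** At level [(k x_j + e) / n], at most 1, the [j]-th tail set has at least
    [k x_j] sample points; at level [(k x_j - e - 1) / n] it has at most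
    [k x_j - 1], which is below the floor of [k x_j].  So
    the counted points lie between the two unions, whose masses differ from that
    at [k x / n] by the increments of the levels. *)
Lemma emp_stdf_near_Ftilde (k : nat) (w : Omega) (e e' N : R) (x : 'I_d -> R) :
  (0 < k)%N -> 0 <= e ->
  (forall j u, 0 <= u <= N / n%:R -> `|deviation X0 X (A j u) w| <= e) ->
  (forall u, (forall j, 0 <= u j <= N / n%:R) ->
    `|deviation X0 X (union_at A u) w| <= e') ->
  (forall j, 0 <= x j) -> (forall j, k%:R * x j + e <= N) ->
  `|emp_stdf k (fun i => X i w) x -
     n%:R / k%:R * Ftilde X0 (fun j => k%:R / n%:R * x j)|
  <= (e' + d%:R * (e + 1)) / k%:R.
Proof.
move=> k0 e0 marg joint x0 xN.
have n0 : 0 < n%:R :> R by rewrite ltr0n.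
have kR0 : 0 < k%:R :> R by rewrite ltr0n.
pose y j := k%:R / n%:R * x j.
have y0 j : 0 <= y j by rewrite /y mulr_ge0// divr_ge0// ler0n.
have nyE j : n%:R * y j = k%:R * x j.
  by rewrite /y; have := lt0r_neq0 n0 => ?; field.
pose up j := y j + e / n%:R.
pose um j := Num.max 0 (y j - (e + 1) / n%:R).
have en : 0 <= e / n%:R by rewrite divr_ge0// ltW.
have e1n : 0 <= (e + 1) / n%:R by rewrite divr_ge0//; lra.
have nup j : n%:R * up j = k%:R * x j + e.
  by rewrite /up mulrDr nyE mulrCA mulfV ?mulr1// gt_eqF.
have up0 j : 0 <= up j by have := y0 j; rewrite /up; lra.
have upN j : up j <= N / n%:R by rewrite ler_pdivlMr// mulrC nup.
have um0 j : 0 <= um j by rewrite /um le_max lexx.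
have umy j : um j <= y j by rewrite /um ge_max y0; lra.
have yup j : y j <= up j by rewrite /up; lra.
have umN j : um j <= N / n%:R by apply: le_trans (upN j); apply: le_trans (yup j).
pose sel i := [exists j, (rank_above w j i)%:Z < Num.floor (k%:R * x j)].
have floor_le j : (Num.floor (k%:R * x j))%:~R <= k%:R * x j by exact: floor_le.
have floor_gt j : k%:R * x j - 1 < (Num.floor (k%:R * x j))%:~R.
  by have /andP[_] := floor_itv (k%:R * x j); rewrite intrD; lra.
have sel_sub : #|[pred i | sel i]|%:R <= #|hits X (union_at A up) w|%:R :> R.
  rewrite ler_nat; apply: subset_leq_card; apply/fintype.subsetP => i.
  rewrite mem_hits inE => /existsP[j hj]; apply/asboolP; exists j.
  (* Beyond level 1 the count cannot grow with k x_j, but the tail set is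
     everything. *)
  have [up1|up1] := ltP 1 (up j); first by rewrite tail_set_gt1.
  apply: tail_set_num_above hj; rewrite -(ler_int R) -pmulrn.
  have := marg j (up j); rewrite up0 upN => /(_ isT).
  rewrite /deviation mass_tail_set// min_l// nup ler_norml.
  by have := floor_le j; lra.
have sub_sel : #|hits X (union_at A um) w|%:R <= #|[pred i | sel i]|%:R :> R.
  rewrite ler_nat; apply: subset_leq_card; apply/fintype.subsetP => i.
  rewrite mem_hits => /asboolP[j hj]; rewrite inE; apply/existsP; exists j.
  have [h|h] := leP (y j - (e + 1) / n%:R) 0.
    by move: hj; rewrite /um max_l// tail_set0.
  apply: num_above_tail_set hj; rewrite -(ltr_int R) -pmulrn.
  have := marg j (um j); rewrite um0 umN => /(_ isT).
  have : n%:R * Num.min (um j) 1 <= k%:R * x j - (e + 1).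
    apply: le_trans (_ : n%:R * um j <= _).
      by rewrite ler_pM2l// ge_min lexx.
    rewrite /um max_r; last exact: ltW.
    by rewrite mulrBr nyE mulrCA mulfV ?mulr1// gt_eqF.
  rewrite /deviation mass_tail_set// ler_norml.
  by have := floor_gt j; lra.
have mU := measurable_union_at (measurable_tail_set X0).
have inc u v : (forall j, 0 <= u j) -> (forall j, u j <= v j) ->
    law_mass X0 (union_at A v) <= law_mass X0 (union_at A u) + \sum_j (v j - u j).
  move=> u0 uv; rewrite -lerBlDl /law_mass -fine_probD//; last first.
    by apply: union_at_mono => //; exact: tail_set_mono.
  apply: mass_union_atD => //; first exact: measurable_tail_set.
  exact: mass_tail_setD.
have up_inc : n%:R * law_mass X0 (union_at A up) <=
    n%:R * law_mass X0 (union_at A y) + d%:R * (e + 1).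
  apply: le_trans (_ : n%:R * (law_mass X0 (union_at A y) +
    \sum_(j < d) (e + 1) / n%:R) <= _).
    rewrite ler_pM2l//; apply: le_trans (inc y up y0 yup) _; rewrite lerD2l.
    apply: ler_sum => j _; rewrite /up addrAC subrr add0r ler_pM2r ?invr_gt0//; lra.
  rewrite mulrDr lerD2l big_const_ord iter_addr_0 -[_ *+ d]mulr_natl.
  by rewrite mulrCA [n%:R * _]mulrCA mulfV ?mulr1// gt_eqF.
have um_inc : n%:R * law_mass X0 (union_at A y) <=
    n%:R * law_mass X0 (union_at A um) + d%:R * (e + 1).
  apply: le_trans (_ : n%:R * (law_mass X0 (union_at A um) +
    \sum_(j < d) (e + 1) / n%:R) <= _).
    rewrite ler_pM2l//; apply: le_trans (inc um y um0 umy) _; rewrite lerD2l.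
    apply: ler_sum => j _; rewrite /um lerBlDr -lerBlDl le_max; apply/orP; right; lra.
  rewrite mulrDr lerD2l big_const_ord iter_addr_0 -[_ *+ d]mulr_natl.
  by rewrite mulrCA [n%:R * _]mulrCA mulfV ?mulr1// gt_eqF.
have dup : `|deviation X0 X (union_at A up) w| <= e'.
  by apply: joint => j; rewrite up0 upN.
have dum : `|deviation X0 X (union_at A um) w| <= e'.
  by apply: joint => j; rewrite um0 umN.
rewrite emp_stdfE FtildeE// [n%:R / _]mulrC -mulrA -mulrBr normrM.
rewrite gtr0_norm ?invr_gt0// [leRHS]mulrC ler_pM2l ?invr_gt0//.
move: dup dum; rewrite !ler_norml /deviation -/y; rewrite -/(sel _); lra.
Qed.

End estimator.

(** * Choice of the confidence level and of the constants *)

Section constants.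
Context (R : realType).

Lemma ln_4_le2 : ln (4 : R) <= 2.
Proof.
by rewrite -[leRHS]expRK ler_ln ?posrE ?expR_gt0// expR2_ge4.
Qed.

(** [4 d / delta] pays for the [d + 1] applications of the uniform deviation,
    each failing with probability at most [2 exp (- s)].  The upper bound
    [T k] is where the lower bounds on [T] and [delta] enter:
    [s = ln 4 + ln d - ln delta] is at most [2 k + ln d + k]. *)
Lemma confidence_level (d k : nat) (T delta : R) :
  (0 < d)%N -> (0 < k)%N -> 7 / 2 * (ln d%:R / k%:R + 1) <= T ->
  0 < delta < 1 -> expR (- k%:R) <= delta ->
  let s := ln (4 * d%:R / delta) in
  [/\ 1 <= s, s <= T * k%:R & s <= 2 * ln ((d + 3)%:R / delta)].
Proof.
move=> d0 k0 hT /andP[de0 de1] kde s.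
have d1 : 1 <= d%:R :> R by rewrite ler1n.
have dR0 : 0 < d%:R :> R by rewrite ltr0n.
have k1 : 1 <= k%:R :> R by rewrite ler1n.
have dinv0 : 0 < delta^-1 by rewrite invr_gt0.
have dinv : 1 <= delta^-1 by rewrite invf_ge1// ltW.
have sE : s = ln 4 + ln d%:R - ln delta.
  by rewrite /s ln_div ?posrE ?mulr_gt0 ?lnM ?posrE.
split.
- rewrite -[leLHS]expRK ler_ln ?posrE ?expR_gt0 ?divr_gt0 ?mulr_gt0//.
  apply: le_trans (_ : 4 <= _); last first.
    by rewrite -[leLHS]mulr1; apply: ler_pM => //; lra.
  have h : expR (1 : R) <= 4.
    have : 1 - 1 / 2 <= expR (- (1 / 2)) :> R by have := expR_ge1Dx (- (1 / 2) : R); lra.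
    have e0 : 0 < expR (1 / 2) :> R by exact: expR_gt0.
    rewrite expRN => h.
    have h2 : expR (1 / 2) <= 2 :> R.
      by have := ler_wpM2r (ltW e0) h; rewrite mulVf ?gt_eqF//; lra.
    have -> : (1 : R) = 1 / 2 + 1 / 2 by lra.
    by rewrite expRD; nra.
  exact: h.
- have lnd : - ln delta <= k%:R.
    by rewrite lerNl -[leLHS]expRK ler_ln ?posrE ?expR_gt0.
  have : 7 / 2 * (ln d%:R / k%:R + 1) * k%:R <= T * k%:R.
    by rewrite ler_wpM2r//; lra.
  have -> : 7 / 2 * (ln d%:R / k%:R + 1) * k%:R = 7 / 2 * (ln d%:R + k%:R) :> R.
    by field; lra.
  have := ln_4_le2; have := ln_ge0 d1; lra.
- have p : 0 < (d + 3)%:R / delta by rewrite divr_gt0// ltr0n addn_gt0 orbT.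
  rewrite mulr_natl -lnXn// ler_ln ?posrE ?divr_gt0 ?exprn_gt0 ?mulr_gt0//.
  rewrite exprMn natrD [delta^-1 ^+ 2]expr2 mulrA ler_pM2r ?invr_gt0//.
  rewrite -[leLHS]mulr1; apply: ler_pM => //; rewrite expr2; nra.
Qed.

(** [121 = 60 + 60 + 1] collects the deviation of the unions and [d] times the
    shift of the levels, and [122 = 61 * 2] comes from the factor [61^2]
    in the range of the levels and from [s <= 2 L]. *)
Lemma final_bound (d k : nat) (T s L Q : R) : (0 < d)%N -> (0 < k)%N ->
  1 <= s -> s <= T * k%:R -> s <= 2 * L ->
  Q = Num.sqrt (61 ^+ 2 * (T * k%:R) * s) ->
  (60 * d%:R * Q + d%:R * (60 * Q + 1)) / k%:R
    <= 121 * 122 * d%:R * Num.sqrt (T / k%:R * L).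
Proof.
move=> d0 k0 s1 sT sL QE.
have k1 : 1 <= k%:R :> R by rewrite ler1n.
have kR0 : 0 < k%:R :> R by rewrite ltr0n.
have kn0 : k%:R != 0 :> R by rewrite gt_eqF.
pose q := Num.sqrt (T * k%:R * s); pose r := Num.sqrt (T / k%:R * L).
have {}QE : Q = 61 * q.
  by rewrite QE -mulrA sqrtrM ?sqr_ge0// sqrtr_sqr ger0_norm.
have q1 : 1 <= q by rewrite -[leLHS]sqrtr1 ler_wsqrtr//; nra.
have qr : q <= 2 * (k%:R * r).
  have -> : 2 * (k%:R * r) = Num.sqrt ((2 * k%:R) ^+ 2 * (T / k%:R * L)).
    rewrite [RHS]sqrtrM ?sqr_ge0// sqrtr_sqr ger0_norm -/r; first by ring.
    by rewrite mulr_ge0// ltW.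
  rewrite ler_wsqrtr//.
  have -> : (2 * k%:R) ^+ 2 * (T / k%:R * L) = T * k%:R * (4 * L) by field.
  by apply: ler_wpM2l; lra.
have d1 : 0 <= d%:R :> R by [].
rewrite -/r ler_pdivrMr// QE.
have h : 60 * (61 * q) + (60 * (61 * q) + 1) <= 121 * 122 * (k%:R * r) by lra.
have := ler_wpM2l d1 h.
rewrite (_ : d%:R * (_ + _) = 60 * d%:R * (61 * q) + d%:R * (60 * (61 * q) + 1)); last by ring.
by move/le_trans; apply; rewrite le_eqVlt; apply/orP; left; apply/eqP; ring.
Qed.

End constants.

(** * Simultaneous deviation of all tail counts *)

Section concentration.
Context (disp : measure_display) (Omega : measurableType disp) (R : realType)
  (P : probability Omega R) (d : nat) (X0 : {RV P >-> d.-tuple R}).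
Context (n : nat) (X : 'I_n -> {RV P >-> d.-tuple R}).
Hypothesis margin_continuous : forall j, continuous (margin_cdf X0 j).
Hypothesis n_gt0 : (0 < n)%N.
Hypothesis iidX : iid_sample X0 X.
Local Notation A := (tail_set X0).

Lemma margin_deviation (j : 'I_d) (N s : R) : 1 <= s -> 36 * s <= N ->
  exists G : set Omega, [/\ measurable G, fine (P (~` G)) <= 2 * expR (- s) &
    forall w, G w -> forall u, 0 <= u <= N / n%:R ->
      `|deviation X0 X (A j u) w| <= 60 * Num.sqrt (N * s)].
Proof.
move=> s1 sN; have [G [mG PG hG]] := @uniform_deviation _ _ _ P _ _ X0 n X
  n_gt0 iidX 1 (fun=> A j) (fun _ u => measurable_tail_set X0 j u)
  (fun _ u v => @tail_set_mono _ _ _ _ _ X0 j u v) (fun=> tail_set0 X0 j)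
  (fun _ u v => @mass_tail_setD _ _ _ _ _ X0 margin_continuous j u v)
  N s (ltn0Sn 0) s1 sN.
exists G; split => // w Gw u hu.
have := hG w Gw (fun=> u) (fun=> hu); rewrite mulr1.
suff -> : union_at (fun=> A j) (fun _ : 'I_1 => u) = A j u by [].
by apply/seteqP; split => [z [_]|z Az] //; exists ord0.
Qed.

(** The margins are treated one by one because their deviation shifts each of the
    [d] levels: the bound for the unions would cost a second factor [d]. *)
Lemma simultaneous_deviation (N s : R) : (0 < d)%N -> 1 <= s -> 36 * s <= N ->
  exists G : set Omega, [/\ measurable G,
    fine (P (~` G)) <= 2 * (d%:R + 1) * expR (- s),
    forall w, G w -> forall j u, 0 <= u <= N / n%:R ->
      `|deviation X0 X (A j u) w| <= 60 * Num.sqrt (N * s) &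
    forall w, G w -> forall u, (forall j, 0 <= u j <= N / n%:R) ->
      `|deviation X0 X (union_at A u) w| <= 60 * d%:R * Num.sqrt (N * s)].
Proof.
move=> d0 s1 sN.
have [G [mG PG hG]] := uniform_deviation n_gt0 iidX (measurable_tail_set X0)
  (@tail_set_mono _ _ _ _ _ X0) (tail_set0 X0) (mass_tail_setD margin_continuous)
  d0 s1 sN.
have [H hH] := choice (fun j => margin_deviation j s1 sN).
pose K (o : option 'I_d) := if o is Some j then ~` H j else ~` G.
have mK o : measurable (K o).
  by case: o => [j|]; apply: measurableC => //; case: (hH j).
have mU : measurable (\bigcup_(o in [set: option 'I_d]) K o).
  by apply: fin_bigcup_measurable.
exists (~` \bigcup_(o in [set: option 'I_d]) K o); split.
- exact: measurableC.
- rewrite setCK; apply: le_trans (fine_prob_union_bound P mU mK _) _ => //.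
  apply: le_trans (_ : \sum_(o : option 'I_d) 2 * expR (- s) <= _).
    by apply: ler_sum => -[j|] _ //=; case: (hH j).
  rewrite sumr_const card_option card_ord -[leLHS]mulr_natr -natr1.
  by rewrite le_eqVlt; apply/orP; left; apply/eqP; ring.
- move=> w nw j; case: (hH j) => _ _; apply.
  by apply: contrapT => h; apply: nw; exists (Some j).
- move=> w nw; apply: hG.
  by apply: contrapT => h; apply: nw; exists None.
Qed.

End concentration.

Theorem theorem6 (R : realType) :
  exists C : R,
  forall (disp : measure_display) (Omega : measurableType disp)
    (P : probability Omega R) (d : nat) (X0 : {RV P >-> d.-tuple R})
    (k : nat -> nat),
  (0 < d)%N ->
  (forall j, continuous (margin_cdf X0 j)) ->
  has_stdf X0 ->
  (forall n, (0 < n)%N -> (0 < k n)%N) ->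
  k @ \oo --> \oo ->
  (k n)%:R / n%:R @[n --> \oo] --> (0 : R) ->
  forall (n : nat) (X : 'I_n -> {RV P >-> d.-tuple R}) (T delta : R),
  (0 < n)%N ->
  iid_sample X0 X ->
  0 < T ->
  7 / 2 * (ln d%:R / (k n)%:R + 1) <= T ->
  0 < delta < 1 ->
  expR (- (k n)%:R) <= delta ->
  ((1 - delta)%:E <=
   P [set w |
       box_sup T (fun x =>
         `|emp_stdf (k n) (fun i => X i w) x - stdf X0 x|%R)
       <= (C * d%:R * Num.sqrt (T / (k n)%:R * ln ((d + 3)%:R / delta)))%:E
          + box_sup (2 * T) (fun x =>
              `|n%:R / (k n)%:R * Ftilde X0 (fun j => (k n)%:R / n%:R * x j)
                - stdf X0 x|)%R])%E.
Proof.
exists (121 * 122) => disp Omega P d X0 k d0 ctn _ k_gt0 _ _ n X T delta n0.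
move=> iidX T0 hT hdelta kdelta.
set L := ln ((d + 3)%:R / delta).
have k0 := k_gt0 n n0; have kR0 : 0 < (k n)%:R :> R by rewrite ltr0n.
have [] := confidence_level d0 k0 hT hdelta kdelta; rewrite -/L.
set s := ln (4 * d%:R / delta) => s1 sT sL.
have /andP[de0 de1] := hdelta.
(* The factor 61^2 makes room for the shifted levels: 60 Q <= 3660 M, so
   M + 60 Q <= N. *)
set M := T * (k n)%:R; pose N : R := 61 ^+ 2 * M; pose Q := Num.sqrt (N * s).
have {}sT : s <= M := sT.
have M1 : 1 <= M by exact: le_trans s1 sT.
have NE : N = 61 * (61 * M) by rewrite /N expr2 mulrA.
have M0 : 0 <= M by lra.
have QM : Q <= 61 * M.
  have M61 : 0 <= 61 * M by rewrite mulr_ge0.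
  rewrite -(ger0_norm M61) -sqrtr_sqr ler_wsqrtr// exprMn -mulrA.
  by rewrite ler_wpM2l ?sqr_ge0// expr2 ler_wpM2l.
have sN : 36 * s <= N by rewrite NE; lra.
have [G [mG PG marg joint]] := simultaneous_deviation ctn n0 iidX d0 s1 sN.
(* Needed because P is monotone between measurable sets only. *)
have mE := measurable_emp_stdf_event (k n) X T (stdf X0).
apply: le_trans (_ : P G <= _)%E; last first.
  apply: le_measure; rewrite ?inE//.
  move=> w Gw /=; apply: ub_ereal_sup => _ [x xT <-].
  have x0 j : 0 <= x j by have /andP[] := xT j.
  have xT' j : x j <= T by have /andP[] := xT j.
  have xN j : (k n)%:R * x j + 60 * Q <= N.
    have : (k n)%:R * x j <= M by rewrite /M mulrC ler_pM2r.
    by rewrite NE; lra.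
  have Q0 : 0 <= 60 * Q by rewrite mulr_ge0 ?sqrtr_ge0.
  have main := emp_stdf_near_Ftilde ctn n0 k0 Q0 (marg w Gw) (joint w Gw) x0 xN.
  have {main} := le_trans main (final_bound d0 k0 s1 sT sL erefl).
  set l := emp_stdf _ _ _; set F := _ * Ftilde _ _ => main.
  apply: le_trans (_ : (121 * 122 * d%:R * Num.sqrt (T / (k n)%:R * L) +
      `|F - stdf X0 x|)%:E <= _)%E.
    rewrite lee_fin; apply: le_trans (_ : `|l - F| + `|F - stdf X0 x| <= _).
      by apply: le_trans (ler_normD _ _); rewrite addrA subrK.
    by rewrite lerD2r.
  rewrite EFinD leeD2l//; apply: ereal_sup_ubound; exists x => //.
  by move=> j; rewrite x0/=; have := xT' j; lra.
rewrite -(fine_probK P mG) lee_fin.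
have := fine_probC P mG.
have d1 : 1 <= d%:R :> R by rewrite ler1n.
have : 2 * (d%:R + 1) * expR (- s) <= delta.
  rewrite expRN lnK ?posrE ?divr_gt0 ?mulr_gt0//; last lra.
  rewrite invf_div mulrA ler_pdivrMr; last lra.
  nra.
lra.
Qed.
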